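(* Let $k$ be a field, $V$ a $k$-vector space, $\mathcal H=T(V)$ and $\mathcal H^+=\bigoplus_{n\ge 1}V^{\otimes n}$, endowed with the shuffle quadri-algebra operations $\searrow,\nearrow,\nwarrow,\swarrow$, the derived dendriform operations $\succ,\prec,\vee,\wedge$, the concatenation product and the deconcatenation coproduct $\Delta(u)=\sum_{u=u^1u^2}u^1\otimes u^2$. Then for any $u\in\mathcal H$ and $v,w\in\mathcal H^+$: \begin{enumerate} \item $u\wedge(vw)=u\nearrow(vw)+u\nwarrow(vw)=\sum_{u=u^1u^2}(u^1\vee v)(u^2\wedge w)$, \item $u\prec(vw)=u\nwarrow(vw)+u\swarrow(vw)=\sum_{u=u^1u^2}(u^1\prec v)(u^2\succ w)$, \item $u\vee(vw)=u\swarrow(vw)+u\searrow(vw)=\sum_{u=u^1u^2}(u^1\vee v)(u^2\vee w)$, \item $u\succ(vw)=u\searrow(vw)+u\nearrow(vw)=\sum_{u=u^1u^2}(u^1\succ v)(u^2\succ w)$. \end{enumerate}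
   Context: $\mathcal H=T(V)=\bigoplus_{n\ge0}V^{\otimes n}$, with empty word $\mathbf 1$ spanning $V^{\otimes 0}=k$. Words (pure tensors) are written $u=u_1\cdots u_p$ with $u_i\in V$. Juxtaposition $uv=m(u\otimes v)$ is concatenation. The deconcatenation coproduct is $\Delta(u)=\sum_{u=u^1u^2}u^1\otimes u^2$; for a word $u$ of length $p$ the sum runs over all $p+1$ ways of cutting $u$ into a prefix $u^1$ and a suffix $u^2$ (each possibly equal to $\mathbf 1$), and the notation $\sum_{u=u^1u^2}$ is extended linearly to all $u\in\mathcal H$. Quadri-algebra operations. Let $\mathrm{Sh}(p,q)$ be the set of permutations $\sigma\in S_{p+q}$ with $\sigma(1)<\cdots<\sigma(p)$ and $\sigma(p+1)<\cdots<\sigma(p+q)$. For $p,q\ge1$, $u=u_1\cdots u_p$ and $v=u_{p+1}\cdots u_{p+q}$, each of the four bilinear operations is given by $\sum_\sigma u_{\sigma^{-1}(1)}u_{\sigma^{-1}(2)}\cdots u_{\sigma^{-1}(p+q)}$, the sum being over the $\sigma\in\mathrm{Sh}(p,q)$ such that: - for $u\searrow v$: $\sigma^{-1}(1)=p+1$ and $\sigma^{-1}(p+q)=p+q$ (first letter and last letter both come from $v$); - for $u\nearrow v$: $\sigma^{-1}(1)=p+1$ and $\sigma^{-1}(p+q)=p$ (first letter from $v$, last letter from $u$); - for $u\nwarrow v$: $\sigma^{-1}(1)=1$ and $\sigma^{-1}(p+q)=p$ (first and last letters from $u$); - for $u\swarrow v$: $\sigma^{-1}(1)=1$ and $\sigma^{-1}(p+q)=p+q$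 (first letter from $u$, last letter from $v$). An empty sum is $0$. For $a\in\mathcal H^+$ one sets $\mathbf 1\searrow a=a$, $\mathbf 1\nearrow a=\mathbf 1\nwarrow a=\mathbf 1\swarrow a=0$, and $a\nwarrow\mathbf 1=a$, $a\nearrow\mathbf 1=a\searrow\mathbf 1=a\swarrow\mathbf 1=0$. (The operations are not defined on $\mathbf 1\otimes\mathbf 1$.) In particular all operations are defined as linear maps $\mathcal H\otimes\mathcal H^+\to\mathcal H^+$. Derived operations: $x\succ y=x\nearrow y+x\searrow y$, $x\prec y=x\nwarrow y+x\swarrow y$, $x\vee y=x\searrow y+x\swarrow y$, $x\wedge y=x\nearrow y+x\nwarrow y$. *)

(* Defs.v *)
From HB Require Import structures.
From mathcomp Require Import all_boot all_order all_algebra all_fingroup.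
From mathcomp Require Import finmap monalg boolp.
From mathcomp Require Import generic_quotient ring_quotient.

Set Implicit Arguments.
Unset Strict Implicit.
Unset Printing Implicit Defensive.

Import GRing.Theory.
Import Quotient.Exports.

Local Open Scope ring_scope.
Local Open Scope quotient_scope.

Section FreeModule.
Variables (k : fieldType) (W : choiceType) (M : lmodType k).

Definition lext (f : W -> M) (x : {malg k[W]}) : M :=
  \sum_(w <- msupp x) x@_w *: f w.

Lemma lextw (f : W -> M) (d : {fset W}) (x : {malg k[W]}) :
  (msupp x `<=` d)%fset -> lext f x = \sum_(w <- d) x@_w *: f w.
Proof.
move=> le_xd; rewrite /lext (big_fset_incl _ le_xd) // => w _ /mcoeff_outdom ->.
by rewrite scale0r.
Qed.

Lemma lext_is_linear f : linear (lext f).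
Proof.
move=> a x y; pose d := (msupp (a *: x + y) `|` (msupp x `|` msupp y))%fset.
have xd : (msupp x `<=` d)%fset by rewrite /d fsubsetU // fsubsetUl orbT.
have yd : (msupp y `<=` d)%fset by rewrite /d fsubsetU // fsubsetUr orbT.
rewrite (lextw _ xd) (lextw _ yd) (@lextw _ d) ?fsubsetUl //.
rewrite scaler_sumr -big_split /=; apply: eq_bigr => w _.
by rewrite mcoeffD mcoeffZ scalerDl scalerA.
Qed.

HB.instance Definition _ f :=
  GRing.isLinear.Build k {malg k[W]} M *:%R (lext f) (lext_is_linear f).

Lemma lextU f w : lext f << w >> = f w.
Proof.
by rewrite /lext msuppU oner_eq0 big_seq_fset1 mcoeffUU scale1r.
Qed.

End FreeModule.

Section Span.
Variables (k : fieldType) (F : lmodType k) (r : F -> Prop).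

Inductive span : F -> Prop :=
| span0 : span 0
| spanS a x y of r x & span y : span (a *: x + y).

Lemma span_linear a x y : span x -> span y -> span (a *: x + y).
Proof.
move=> + Sy; elim=> [|b z t rz _ IH]; first by rewrite scaler0 add0r.
by rewrite scalerDr scalerA -addrA; apply: spanS.
Qed.

Lemma span_gen x : r x -> span x.
Proof. by move=> rx; rewrite -[x]addr0 -[x]scale1r; apply: spanS span0. Qed.

Definition spanb : {pred F} := fun x => `[< span x >].

Lemma spanbP x : reflect (span x) (x \in spanb).
Proof. exact: asboolP. Qed.

Lemma spanb_zmod : zmod_closed spanb.
Proof.
split=> [|x y /spanbP Sx /spanbP Sy]; apply/spanbP; first exact: span0.
by rewrite addrC -scaleN1r; apply: span_linear.
Qed.

HB.instance Definition _ := GRing.isZmodClosed.Build F spanb spanb_zmod.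

End Span.

Definition lquot (k : fieldType) (F : lmodType k) (r : F -> Prop) :=
  Quotient.quot (spanb r).

Section Quotient.
Variables (k : fieldType) (F : lmodType k) (r : F -> Prop).
Local Notation Q := (lquot r).

HB.instance Definition _ := GRing.Zmodule.on Q.
HB.instance Definition _ := Quotient.on Q.

Definition qpi (x : F) : Q := \pi_Q x.

Lemma qpiP x y : qpi x = qpi y <-> span r (x - y).
Proof.
rewrite /qpi; split=> [/eqP|Sxy]; first by rewrite -Quotient.idealrBE => /spanbP.
by apply/eqP; rewrite -Quotient.idealrBE; apply/spanbP.
Qed.

Lemma qpiD x y : qpi (x + y) = qpi x + qpi y.
Proof. exact: (raddfD \pi_Q). Qed.

Lemma qpi0 x : r x -> qpi x = 0.
Proof.
move=> rx; have /qpiP-> : span r (x - 0) by rewrite subr0; apply: span_gen.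
exact: (raddf0 \pi_Q).
Qed.

Definition qscale (a : k) (x : Q) : Q := qpi (a *: repr x).

Lemma qpi_repr x : qpi (repr x) = x.
Proof. exact: reprK. Qed.

Lemma qpiZ a x : qpi (a *: x) = qscale a (qpi x).
Proof.
apply/qpiP; rewrite -scalerBr -[_ *: _]addr0; apply: span_linear; last exact: span0.
by apply/qpiP; rewrite qpi_repr.
Qed.

Lemma qscaleA a b x : qscale a (qscale b x) = qscale (a * b) x.
Proof. by rewrite -[x]qpi_repr -!qpiZ scalerA. Qed.
Lemma qscale1 : left_id 1 qscale.
Proof. by move=> x; rewrite -[x]qpi_repr -!qpiZ scale1r. Qed.
Lemma qscaleDr : right_distributive qscale +%R.
Proof.
by move=> a x y; rewrite -[x]qpi_repr -[y]qpi_repr -!(qpiZ, qpiD) scalerDr.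
Qed.
Lemma qscaleDl x : {morph qscale^~ x : a b / a + b}.
Proof. by move=> a b; rewrite -[x]qpi_repr -!(qpiZ, qpiD) scalerDl. Qed.

HB.instance Definition _ := GRing.Zmodule_isLmodule.Build k Q
  qscaleA qscale1 qscaleDr qscaleDl.

Lemma qpi_is_linear : linear qpi.
Proof. by move=> a x y; rewrite qpiD qpiZ. Qed.

HB.instance Definition _ := GRing.isLinear.Build k F Q *:%R qpi qpi_is_linear.

End Quotient.

(* The linear map induced on a quotient of a free module by f, defined through
   representatives; qlift_pi and qlift_linear show that it is the intended
   map as soon as f respects the relations. *)
Definition qlift (k : fieldType) (W : choiceType) (r : {malg k[W]} -> Prop)
    (M : lmodType k) (f : W -> M) (x : lquot r) : M :=
  lext f (repr x).

Section Lift.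
Variables (k : fieldType) (W : choiceType) (r : {malg k[W]} -> Prop).
Variables (M : lmodType k).

Lemma qlift_pi (f : W -> M) x :
  (forall y, r y -> lext f y = 0) -> qlift f (qpi r x) = lext f x.
Proof.
move=> fr; apply/eqP; rewrite -subr_eq0 -linearB; apply/eqP.
have : span r (repr (qpi r x) - x) by apply/qpiP; rewrite qpi_repr.
elim=> [|a y z ry _ IH]; first exact: linear0.
by rewrite linearP [X in _ + X]IH /= fr // scaler0 addr0.
Qed.

Lemma qlift_linear (f : W -> M) :
  (forall y, r y -> lext f y = 0) -> linear (qlift (r := r) f).
Proof.
move=> fr a x y; rewrite -[x]qpi_repr -[y]qpi_repr -linearP.
by rewrite !qlift_pi // linearP /=.
Qed.

Lemma qlift_ext (f g : W -> M) (x : lquot r) : f =1 g -> qlift f x = qlift g x.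
Proof. by move=> fg; apply: eq_bigr => w _; rewrite fg. Qed.

End Lift.

Lemma linear_at0 (k : fieldType) (M N : lmodType k) (h : M -> N) :
  linear h -> h 0 = 0.
Proof.
by move=> hl; have := hl (-1) 0 0; rewrite scaler0 addr0 scaleN1r addNr.
Qed.

Section TensorProduct.
Variables (k : fieldType) (A B : lmodType k).

Inductive bilinear_rel : {malg k[(A * B)%type]} -> Prop :=
| bilinear_rel_l c x y z :
    bilinear_rel (<< (c *: x + y, z) >> - c *: << (x, z) >> - << (y, z) >>)
| bilinear_rel_r c x y z :
    bilinear_rel (<< (x, c *: y + z) >> - c *: << (x, y) >> - << (x, z) >>).

Definition tprod := lquot bilinear_rel.

HB.instance Definition _ := GRing.Lmodule.on tprod.

Definition tpure (x : A) (y : B) : tprod := qpi bilinear_rel << (x, y) >>.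

Definition tlift (M : lmodType k) (f : A -> B -> M) : tprod -> M :=
  qlift (fun xy => f xy.1 xy.2).

Section LiftTheory.
Variables (M : lmodType k) (f : A -> B -> M).
Hypotheses (fl : forall y, linear (f^~ y)) (fr : forall x, linear (f x)).

Lemma bilinear_rel0 x :
  bilinear_rel x -> lext (fun xy => f xy.1 xy.2) x = 0.
Proof.
by case=> c a b d; rewrite !linearB linearZ /= !lextU /= (fl, fr);
  rewrite addrAC addrK subrr.
Qed.

Lemma tlift_pure x y : tlift f (tpure x y) = f x y.
Proof. by rewrite /tlift qlift_pi ?lextU //; apply: bilinear_rel0. Qed.

Lemma tlift_linear : linear (tlift f).
Proof. by apply: qlift_linear; apply: bilinear_rel0. Qed.

End LiftTheory.

Lemma tpure_linl y : linear (tpure^~ y).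
Proof.
move=> c x x'; apply/eqP; rewrite -subr_eq0 opprD addrA -linearZ -!linearB /=.
by rewrite qpi0 //; apply: bilinear_rel_l.
Qed.

Lemma tpure_linr x : linear (tpure x).
Proof.
move=> c y y'; apply/eqP; rewrite -subr_eq0 opprD addrA -linearZ -!linearB /=.
by rewrite qpi0 //; apply: bilinear_rel_r.
Qed.

End TensorProduct.

Section TensorAlgebra.
Variables (k : fieldType) (V : lmodType k).

Inductive multilinear_rel : {malg k[seq V]} -> Prop :=
| Multilinear_rel s t c x y : multilinear_rel
    (<< s ++ (c *: x + y) :: t >> - c *: << s ++ x :: t >> - << s ++ y :: t >>).

(* Since the relations preserve the length of words, this is the direct sum
   of the tensor powers of V. *)
Definition tensor := lquot multilinear_rel.

HB.instance Definition _ := GRing.Lmodule.on tensor.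

Definition word (s : seq V) : tensor := qpi multilinear_rel << s >>.

Definition multilinear (M : lmodType k) (f : seq V -> M) :=
  forall s t c x y,
    f (s ++ (c *: x + y) :: t) = c *: f (s ++ x :: t) + f (s ++ y :: t).

Lemma word_multilinear : multilinear word.
Proof.
move=> s t c x y; apply/eqP; rewrite -subr_eq0 opprD addrA -linearZ -!linearB /=.
by rewrite qpi0.
Qed.

Definition wlift (M : lmodType k) (f : seq V -> M) : tensor -> M := qlift f.

Lemma multilinear_rel0 (M : lmodType k) (f : seq V -> M) : multilinear f ->
  forall x, multilinear_rel x -> lext f x = 0.
Proof.
move=> fm _ [s t c x y]; rewrite !linearB linearZ /= !lextU fm.
by rewrite addrAC addrK subrr.
Qed.

Lemma wlift_word (M : lmodType k) (f : seq V -> M) s :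
  multilinear f -> wlift f (word s) = f s.
Proof.
by move=> fm; rewrite /wlift qlift_pi ?lextU //; apply: multilinear_rel0.
Qed.

Lemma wlift_linear (M : lmodType k) (f : seq V -> M) :
  multilinear f -> linear (wlift f).
Proof. by move=> fm; apply: qlift_linear; apply: multilinear_rel0. Qed.

Lemma tensor_ind (P : tensor -> Prop) :
  P 0 -> (forall c s x, P x -> P (c *: word s + x)) -> forall x, P x.
Proof.
move=> P0 PS x; rewrite -[x]qpi_repr (monalgE (repr x)).
elim: (enum_fset _) => [|s d IH]; first by rewrite big_nil linear0.
rewrite big_cons linearD /=.
suff -> : qpi multilinear_rel << (repr x)@_s *g s >> = (repr x)@_s *: word s.
  exact: PS.
rewrite /word -linearZ /=; congr qpi.
by apply/malgP => t; rewrite mcoeffZ !mcoeffU mulrnAr mulr1.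
Qed.

Lemma linear_word_ext (M : lmodType k) (f g : tensor -> M) :
  linear f -> linear g -> (forall s, f (word s) = g (word s)) -> f =1 g.
Proof.
move=> fl gl fg; elim/tensor_ind => [|c s x IH]; first by rewrite !linear_at0.
by rewrite fl gl IH fg.
Qed.

Definition wlift2 (M : lmodType k) (f : seq V -> seq V -> M) (x y : tensor) : M :=
  wlift (fun s => wlift (f s) y) x.

Section Bilinear.
Variables (M : lmodType k) (f : seq V -> seq V -> M).
Hypotheses (fl : forall t, multilinear (f^~ t)) (fr : forall s, multilinear (f s)).

Let mul_l y : multilinear (fun s => wlift (f s) y).
Proof.
move=> s t c a b; pose h x := c *: wlift (f (s ++ a :: t)) x
  + wlift (f (s ++ b :: t)) x.
apply: (linear_word_ext (g := h)) y; first exact: wlift_linear.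
  move=> d y z; rewrite /h !wlift_linear // !scalerDr !scalerA mulrC !addrA.
  by congr (_ + _); rewrite addrAC.
by move=> y; rewrite /h !wlift_word // fl.
Qed.

Lemma wlift2_word s t : wlift2 f (word s) (word t) = f s t.
Proof. by rewrite /wlift2 !wlift_word. Qed.

Lemma wlift2_linl y : linear (wlift2 f ^~ y).
Proof. exact: wlift_linear. Qed.

Lemma wlift2_linr x : linear (wlift2 f x).
Proof.
have wE y : wlift2 f x y = \sum_(s <- msupp (repr x)) (repr x)@_s *: wlift (f s) y.
  by [].
move=> c y z; rewrite !wE scaler_sumr -big_split /=; apply: eq_bigr => s _.
by rewrite wlift_linear // scalerDr !scalerA mulrC.
Qed.

End Bilinear.

Definition tmul : tensor -> tensor -> tensor :=
  wlift2 (fun s t => word (s ++ t)).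

Let cat_l t : multilinear (fun s => word (s ++ t)).
Proof. by move=> s1 s2 c x y; rewrite -!catA !cat_cons word_multilinear. Qed.
Let cat_r s : multilinear (fun t => word (s ++ t)).
Proof. by move=> s1 s2 c x y; rewrite !catA word_multilinear. Qed.

Lemma tmul_word s t : tmul (word s) (word t) = word (s ++ t).
Proof. exact: (wlift2_word cat_l cat_r). Qed.
Let tmul_linl y : linear (tmul^~ y).
Proof. exact: (wlift2_linl cat_l cat_r). Qed.
Let tmul_linr x : linear (tmul x).
Proof. exact: (wlift2_linr cat_r). Qed.

Lemma tmulDl : left_distributive tmul +%R.
Proof. by move=> x y z; rewrite -[x]scale1r tmul_linl !scale1r. Qed.
Lemma tmulDr : right_distributive tmul +%R.
Proof. by move=> x y z; rewrite -[y]scale1r tmul_linr !scale1r. Qed.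
Let tmul0l x : tmul 0 x = 0.
Proof. by apply: (addrI (tmul 0 x)); rewrite -tmulDl !addr0. Qed.
Let tmul0r x : tmul x 0 = 0.
Proof. by apply: (addrI (tmul x 0)); rewrite -tmulDr !addr0. Qed.
Lemma tscaleAl c x y : c *: tmul x y = tmul (c *: x) y.
Proof. by rewrite -[c *: x]addr0 tmul_linl tmul0l addr0. Qed.
Lemma tscaleAr c x y : c *: tmul x y = tmul x (c *: y).
Proof. by rewrite -[c *: y]addr0 tmul_linr tmul0r addr0. Qed.

Lemma tmulA : associative tmul.
Proof.
move=> x y z; pose F x y z := tmul x (tmul y z); pose G x y z := tmul (tmul x y) z.
apply: (linear_word_ext (f := fun x => F x y z) (g := fun x => G x y z)) x.
- exact: tmul_linl.
- by move=> c a b; rewrite /G (tmul_linl y c a b) (tmul_linl z).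
move=> s; apply: (linear_word_ext (f := fun y => F _ y z) (g := fun y => G _ y z)) y.
- by move=> c a b; rewrite /F (tmul_linl z c a b) (tmul_linr (word s)).
- by move=> c a b; rewrite /G (tmul_linr (word s) c a b) (tmul_linl z).
move=> t; apply: (linear_word_ext (f := F _ _) (g := G _ _)) z.
- by move=> c a b; rewrite /F (tmul_linr (word t) c a b) (tmul_linr (word s)).
- exact: tmul_linr.
by move=> r; rewrite /F /G (tmul_word t) (tmul_word s) !tmul_word catA.
Qed.

Lemma tmul1l : left_id (word [::]) tmul.
Proof.
move=> x; apply: (linear_word_ext (f := tmul (word [::])) (g := id)) x => [||s].
- exact: tmul_linr.
- by move=> c a b.
- by rewrite tmul_word.
Qed.
Lemma tmul1r : right_id (word [::]) tmul.
Proof.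
move=> x; apply: (linear_word_ext (f := tmul^~ (word [::])) (g := id)) x => [||s].
- exact: tmul_linl.
- by move=> c a b.
- by rewrite tmul_word cats0.
Qed.

Lemma tone_neq0 : word [::] != 0.
Proof.
pose e (s : seq V) : k^o := (nilp s)%:R.
have em : multilinear e.
  by move=> [|z s] t c x y; rewrite /e /= ?scaler0 ?addr0.
apply/eqP => w0; have := wlift_word [::] em; rewrite w0 (linear_at0 (wlift_linear em)).
by move/eqP; rewrite eq_sym oner_eq0.
Qed.

HB.instance Definition _ := GRing.Zmodule_isNzRing.Build tensor
  tmulA tmul1l tmul1r tmulDl tmulDr tone_neq0.
HB.instance Definition _ := GRing.Lmodule_isLalgebra.Build k tensor tscaleAl.
HB.instance Definition _ := GRing.Lalgebra_isAlgebra.Build k tensor tscaleAr.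

Lemma word_cat s t : word (s ++ t) = word s * word t.
Proof. by rewrite -tmul_word. Qed.

(* H^+, the sum of the tensor powers of positive exponent. *)
Definition tensor_pos (x : tensor) : Prop :=
  span (fun y => exists2 s, s != [::] & y = word s) x.

Definition deconc_word (s : seq V) : tprod tensor tensor :=
  \sum_(i < (size s).+1) tpure (word (take i s)) (word (drop i s)).

Definition deconc : tensor -> tprod tensor tensor := wlift deconc_word.

Lemma deconc_word_multilinear : multilinear deconc_word.
Proof.
move=> s t c x y; rewrite /deconc_word !size_cat /=.
rewrite scaler_sumr -big_split /=; apply: eq_bigr => i _.
rewrite !take_cat !drop_cat; case: ltngtP => [_|lt_si|->].
- by rewrite word_multilinear tpure_linr.
- by rewrite -(subnSK lt_si) /= word_multilinear tpure_linl.
- by rewrite subnn !take0 !drop0 (word_multilinear [::]) tpure_linr.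
Qed.

Lemma deconc_wordE s : deconc (word s) =
  \sum_(i < (size s).+1) tpure (word (take i s)) (word (drop i s)).
Proof. exact: (wlift_word s deconc_word_multilinear). Qed.

Lemma deconc_linear : linear deconc.
Proof. exact: (wlift_linear deconc_word_multilinear). Qed.

(* The sum over u = u^1 u^2 of B u^1 u^2, for B bilinear. *)
Definition sum_deconc (M : lmodType k) (B : tensor -> tensor -> M) (u : tensor) : M :=
  tlift B (deconc u).

Lemma sum_deconc_word (M : lmodType k) (B : tensor -> tensor -> M) s :
    (forall y, linear (B^~ y)) -> (forall x, linear (B x)) ->
  sum_deconc B (word s) =
    \sum_(i < (size s).+1) B (word (take i s)) (word (drop i s)).
Proof.
move=> Bl Br; rewrite /sum_deconc deconc_wordE.
have tlD : {morph tlift B : x y / x + y}.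
  by move=> x y; have := tlift_linear Bl Br 1 x y; rewrite !scale1r.
rewrite (big_morph (tlift B) tlD (linear_at0 (tlift_linear Bl Br))).
by apply: eq_bigr => i _; apply: tlift_pure.
Qed.

(* Sh(p,q), with 0-based positions. *)
Definition shuffles (p q : nat) : {set 'S_(p + q)} :=
  [set s : 'S_(p + q) | [forall i : 'I_(p + q), forall j : 'I_(p + q),
     ((i < j) && ((j < p) || (p <= i)))%N ==> (s i < s j)%N]].

(* The sequence sigma^-1(0), ..., sigma^-1(n-1). *)
Definition inv_seq (n : nat) (s : 'S_n) : seq nat :=
  [seq val ((s^-1)%g i) | i <- enum 'I_n].

(* The sum of the shuffles of the first p and the last q letters of x whose
   first letter comes from the second word iff a holds, and whose last letter
   comes from the second word iff b holds. *)
Definition quadri_shuffle (a b : bool) (p q : nat) (x : seq V) : tensor :=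
  \sum_(s in shuffles p q |
      (head 0%N (inv_seq s) == if a then p else 0%N)
      && (last 0%N (inv_seq s) == if b then (p + q).-1 else p.-1))
    word [seq nth 0 x i | i <- inv_seq s].

(* The value at two empty words is a placeholder: the operations are only
   meaningful when at least one of the arguments is in H^+. *)
Definition quadri_word (a b : bool) (u v : seq V) : tensor :=
  match u, v with
  | [::], [::] => 0
  | [::], _ => if a && b then word v else 0
  | _, [::] => if ~~ a && ~~ b then word u else 0
  | _, _ => quadri_shuffle a b (size u) (size v) (u ++ v)
  end.

Definition quadri (a b : bool) : tensor -> tensor -> tensor :=
  wlift2 (quadri_word a b).

Lemma quadri_shuffle_multilinear a b p q s t c x y :
    (size s + size t).+1 = (p + q)%N ->
  quadri_shuffle a b p q (s ++ (c *: x + y) :: t) =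
    c *: quadri_shuffle a b p q (s ++ x :: t) + quadri_shuffle a b p q (s ++ y :: t).
Proof.
move=> szst; rewrite /quadri_shuffle scaler_sumr -big_split /=.
apply: eq_bigr => g _.
have s_g : size s \in inv_seq g.
  have lt_s : (size s < p + q)%N by rewrite -szst ltnS leq_addr.
  by apply/mapP; exists (g (Ordinal lt_s)); rewrite ?mem_enum // permK.
have : uniq (inv_seq g).
  by rewrite map_inj_uniq ?enum_uniq // => i j /val_inj/perm_inj.
case/splitPr: s_g => l1 l2; rewrite uniq_catC /= mem_cat negb_or -andbA.
case/and3P=> nl2 nl1 _.
have nthE z i : i != size s -> nth 0 (s ++ z :: t) i = nth 0 (s ++ 0 :: t) i.
  rewrite !nth_cat; case: ltngtP => // lt_si _.
  by rewrite -(subnSK lt_si).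
have mapE z l : size s \notin l ->
    [seq nth 0 (s ++ z :: t) i | i <- l] = [seq nth 0 (s ++ 0 :: t) i | i <- l].
  move=> nl; apply/eq_in_map => i il; apply: nthE.
  by apply: contraNneq nl => <-.
rewrite !map_cat /= !nth_cat ltnn subnn /= !(mapE _ l1, mapE _ l2) //.
exact: word_multilinear.
Qed.

Lemma quadri_word_linl a b v : multilinear ((quadri_word a b)^~ v).
Proof.
move=> s t c x y; have E z w : quadri_word a b (s ++ z :: t) w =
    if nilp w then (if ~~ a && ~~ b then word (s ++ z :: t) else 0)
    else quadri_shuffle a b (size s + size t).+1 (size w) (s ++ z :: t ++ w).
  by rewrite -addnS -[(size t).+1]/(size (z :: t)) -size_cat -cat_cons catA;
    case: s w => [|? ?] [|? ?].
rewrite !E; case: ifP => _; first by case: ifP; rewrite ?scaler0 ?addr0 // word_multilinear.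
by apply: quadri_shuffle_multilinear; rewrite size_cat addnA addSn.
Qed.

Lemma quadri_word_linr a b u : multilinear (quadri_word a b u).
Proof.
move=> s t c x y; have E z w : quadri_word a b w (s ++ z :: t) =
    if nilp w then (if a && b then word (s ++ z :: t) else 0)
    else quadri_shuffle a b (size w) (size s + size t).+1 ((w ++ s) ++ z :: t).
  by rewrite -addnS -[(size t).+1]/(size (z :: t)) -size_cat -catA;
    case: s w => [|? ?] [|? ?].
rewrite !E; case: ifP => _; first by case: ifP; rewrite ?scaler0 ?addr0 // word_multilinear.
by apply: quadri_shuffle_multilinear; rewrite size_cat addnS addnA.
Qed.

Lemma quadriE a b s t : quadri a b (word s) (word t) = quadri_word a b s t.
Proof. exact: (wlift2_word (quadri_word_linl a b) (quadri_word_linr a b)). Qed.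
Lemma quadri_linl a b y : linear ((quadri a b)^~ y).
Proof. exact: (wlift2_linl (quadri_word_linl a b) (quadri_word_linr a b)). Qed.
Lemma quadri_linr a b x : linear (quadri a b x).
Proof. exact: (wlift2_linr (quadri_word_linr a b)). Qed.

Definition searrow := quadri true true.
Definition nearrow := quadri true false.
Definition nwarrow := quadri false false.
Definition swarrow := quadri false true.

Definition dsucc (x y : tensor) := nearrow x y + searrow x y.
Definition dprec (x y : tensor) := nwarrow x y + swarrow x y.
Definition dvee (x y : tensor) := searrow x y + swarrow x y.
Definition dwedge (x y : tensor) := nearrow x y + nwarrow x y.

End TensorAlgebra.

Notation "x \searrow y" := (searrow x y) (at level 45, no associativity) : ring_scope.
Notation "x \nearrow y" := (nearrow x y) (at level 45, no associativity) : ring_scope.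
Notation "x \nwarrow y" := (nwarrow x y) (at level 45, no associativity) : ring_scope.
Notation "x \swarrow y" := (swarrow x y) (at level 45, no associativity) : ring_scope.
Notation "x \succ y" := (dsucc x y) (at level 45, no associativity) : ring_scope.
Notation "x \prec y" := (dprec x y) (at level 45, no associativity) : ring_scope.
Notation "x \vee y" := (dvee x y) (at level 45, no associativity) : ring_scope.
Notation "x \wedge y" := (dwedge x y) (at level 45, no associativity) : ring_scope.

(* Main.v *)
(* Let S(u,v) denote the sum of all shuffles of two words. Singling out the
   first or the last letter of a shuffle gives, for letters x, y and v nonempty
   on the left-hand sides,
     (x u) \prec v = x S(u,v),     u \succ (y v) = y S(u,v),
     (u x) \wedge v = S(u,v) x,    u \vee (v y) = S(u,v) y,
   while 1 \prec v = 1 \wedge v = 0. All four identities then follow from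
     S(u, v y w) = \sum_(u = u1 u2) S(u1,v) y S(u2,w),
   obtained by cutting each shuffle of u with v y w around the letter y. *)
Require Import Defs.
From mathcomp Require Import all_boot all_algebra all_fingroup.

Set Implicit Arguments.
Unset Strict Implicit.
Unset Printing Implicit Defensive.

Import GRing.Theory.

Local Open Scope ring_scope.

(** * Shuffles of two words, listed recursively by their first letter *)

Fixpoint shuf (T : Type) (u : seq T) : seq T -> seq (seq T) :=
  if u is x :: u' then
    fix shufx v := if v is y :: v'
      then map (cons x) (shuf u' v) ++ map (cons y) (shufx v') else [:: u]
  else fun v => [:: v].

Section ShuffleLists.

Lemma shuf_nil (T : Type) (u : seq T) : shuf u [::] = [:: u].
Proof. by case: u. Qed.

Lemma shuf_cons (T : Type) (x y : T) u v : shuf (x :: u) (y :: v) =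
  map (cons x) (shuf u (y :: v)) ++ map (cons y) (shuf (x :: u) v).
Proof. by []. Qed.

Lemma map_shuf (T U : Type) (f : T -> U) u v :
  map (map f) (shuf u v) = shuf (map f u) (map f v).
Proof.
elim: u v => [|x u IHu] // v; elim: v => [|y v IHv] //.
rewrite !map_cons !shuf_cons map_cat -!map_comp -IHv -map_cons -IHu.
by rewrite -!map_comp.
Qed.

Variable T : eqType.
Implicit Types (u v z : seq T).

Lemma mem_map_cons x y z (s : seq (seq T)) :
  (x :: z \in map (cons y) s) = (x == y) && (z \in s).
Proof.
apply/mapP/andP => [[t ts [-> ->]]|[/eqP-> zs]]; last by exists z.
by rewrite eqxx.
Qed.

Lemma subseq_perm_eq v z : subseq v z && perm_eq z v = (z == v).
Proof.
apply/andP/eqP => [[vz /perm_size zv]|->]; last by rewrite subseq_refl.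
by apply/esym/eqP; rewrite -(size_subseq_leqif vz) zv.
Qed.

(** A description free of recursion: it is symmetric under reversal, and it is what the permutations
    in [shuffles] are later compared with. *)
Lemma mem_shuf u v z : uniq (u ++ v) ->
  (z \in shuf u v) = [&& subseq u z, subseq v z & perm_eq z (u ++ v)].
Proof.
case: u => [|x u].
  by move=> _; rewrite sub0seq subseq_perm_eq inE.
elim: z x u v => [|a z IH] x u [|y v] uv.
- by rewrite cats0 sub0seq shuf_nil.
- rewrite shuf_cons mem_cat.
  by apply/orP => -[] /mapP[].
- by rewrite cats0 sub0seq shuf_nil inE subseq_perm_eq.
rewrite shuf_cons mem_cat !mem_map_cons.
have nxy : x != y.
  by apply: contraTneq uv => ->; rewrite /= mem_cat inE eqxx orbT.
have uv1 : uniq (u ++ y :: v) by case/andP: uv.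
have uv2 : uniq ((x :: u) ++ v).
  by apply: subseq_uniq uv; rewrite cat_subseq ?subseq_cons.
rewrite [subseq (x :: u) _]/= [subseq (y :: v) _]/=.
rewrite ![_ == a]eq_sym.
case: (eqVneq a x) => [->|nax].
  rewrite (negPf nxy) orbF andTb cat_cons perm_cons.
  (* The induction hypothesis covers only nonempty first words, so the case where x was the sole
     letter is treated apart. *)
  by case: u {uv uv2} uv1 => [|x' u] uv1; [rewrite inE sub0seq subseq_perm_eq|exact: IH].
case: (eqVneq a y) => [->|nay] /=.
  rewrite -cat_cons.
  rewrite IH //; congr [&& _, _ & _].
  by rewrite -(perm_cons y) ![perm_eq (y :: z) _]perm_sym -(cat1s y v) perm_catCA.
(* If [a] is neither x nor y, both words are already subsequences of the tail z, which is too short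
   to hold all their distinct letters. *)
apply/esym/negbTE/negP => /and3P[uz vz /perm_size eq_sz].
suff: (size (a :: z) <= size z)%N by rewrite ltnn.
rewrite eq_sz uniq_leq_size // => t; rewrite -cat_cons mem_cat => /orP[].
  exact: (mem_subseq uz).
exact: (mem_subseq vz).
Qed.

Lemma shuf_uniq u v : uniq (u ++ v) -> uniq (shuf u v).
Proof.
elim: u v => [|x u IHu] // v; elim: v => [|y v IHv] // uv.
have nxy : x != y.
  by apply: contraTneq uv => ->; rewrite /= mem_cat inE eqxx orbT.
have uv1 : uniq (u ++ y :: v) by case/andP: uv.
have uv2 : uniq ((x :: u) ++ v).
  by apply: subseq_uniq uv; rewrite cat_subseq ?subseq_cons.
rewrite shuf_cons cat_uniq !map_inj_uniq => [|? ? [] //|? ? [] //].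
rewrite IHu ?IHv // andbT; apply/hasPn => _ /mapP[z _ ->].
by rewrite mem_map_cons eq_sym (negPf nxy).
Qed.

(** The recursion of [shuf] only sees first letters; reversal carries its consequences over to last
    letters. The two lists may be ordered differently, hence [perm_eq], which suffices for sums. *)
Lemma shuf_rev u v : uniq (u ++ v) ->
  perm_eq (shuf (rev u) (rev v)) (map rev (shuf u v)).
Proof.
move=> uv; have uvr : uniq (rev u ++ rev v) by rewrite -rev_cat rev_uniq uniq_catC.
apply: uniq_perm; rewrite ?map_inj_uniq ?shuf_uniq //; first exact: inv_inj revK.
move=> z; rewrite -[z]revK (mem_map (inv_inj revK)) revK !mem_shuf //.
rewrite -[z in LHS]revK !subseq_rev !perm_rev -rev_cat.
by rewrite ![perm_eq z _]perm_sym perm_rev perm_catC.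
Qed.

Section HeadSum.
Variables (M : nmodType) (F : seq T -> M) (x y x0 : T) (u v : seq T).
Hypothesis uv : uniq ((x :: u) ++ y :: v).

Let nxy : x != y.
Proof. by apply: contraTneq uv => ->; rewrite /= mem_cat inE eqxx orbT. Qed.

(** Since x and y differ, the test on the head selects exactly one of the two halves of
    [shuf_cons]. *)
Lemma sum_shuf_headl :
  \sum_(z <- shuf (x :: u) (y :: v) | head x0 z == x) F z =
    \sum_(z <- shuf u (y :: v)) F (x :: z).
Proof.
rewrite shuf_cons big_cat !big_map /= [X in _ + X]big_pred0 ?addr0.
  by apply: eq_bigl => z; rewrite eqxx.
by move=> z; rewrite eq_sym (negPf nxy).
Qed.

Lemma sum_shuf_headr :
  \sum_(z <- shuf (x :: u) (y :: v) | head x0 z == y) F z =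
    \sum_(z <- shuf (x :: u) v) F (y :: z).
Proof.
rewrite shuf_cons big_cat !big_map /= [X in X + _]big_pred0 ?add0r.
  by apply: eq_bigl => z; rewrite eqxx.
by move=> z; rewrite (negPf nxy).
Qed.

Lemma head_shuf z : z \in shuf (x :: u) (y :: v) ->
  (head x0 z == y) = (head x0 z != x).
Proof.
rewrite shuf_cons mem_cat => /orP[] /mapP[t _ ->] /=.
  by rewrite eqxx (negPf nxy).
by rewrite eqxx eq_sym nxy.
Qed.

End HeadSum.

Section LastSum.
Variables (M : nmodType) (F : seq T -> M) (x y x0 : T) (u v : seq T).
Hypothesis uv : uniq (rcons u x ++ rcons v y).

Let uvr : uniq (rev (rcons u x) ++ rev (rcons v y)).
Proof. by rewrite -rev_cat rev_uniq uniq_catC. Qed.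

Let last_rev z : last x0 z = head x0 (rev z).
Proof. by rewrite -[z in LHS]revK; case: (rev z) => // a s; rewrite rev_cons last_rcons. Qed.

(** Mirror image of [sum_shuf_headl]: both words are written as double reversals, so that [shuf_rev]
    turns the test on the last letter into a test on the head. *)
Lemma sum_shuf_lastl :
  \sum_(z <- shuf (rcons u x) (rcons v y) | last x0 z == x) F z =
    \sum_(z <- shuf u (rcons v y)) F (rcons z x).
Proof.
have uvl : uniq (u ++ rcons v y).
  by apply: subseq_uniq uv; rewrite cat_subseq ?subseq_rcons.
rewrite -(revK (rcons u x)) -{1}(revK (rcons v y)) (perm_big _ (shuf_rev uvr)) big_map.
under eq_bigl => z do rewrite last_rev revK.
rewrite !rev_rcons sum_shuf_headl -?rev_rcons // (perm_big _ (shuf_rev uvl)) big_map.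
by apply: eq_bigr => z _; rewrite rev_cons revK.
Qed.

Lemma sum_shuf_lastr :
  \sum_(z <- shuf (rcons u x) (rcons v y) | last x0 z == y) F z =
    \sum_(z <- shuf (rcons u x) v) F (rcons z y).
Proof.
have uvl : uniq (rcons u x ++ v).
  by apply: subseq_uniq uv; rewrite cat_subseq ?subseq_rcons.
rewrite -{1}(revK (rcons u x)) -(revK (rcons v y)) (perm_big _ (shuf_rev uvr)) big_map.
under eq_bigl => z do rewrite last_rev revK.
rewrite !rev_rcons sum_shuf_headr -?rev_rcons // (perm_big _ (shuf_rev uvl)) big_map.
by apply: eq_bigr => z _; rewrite rev_cons revK.
Qed.

Lemma last_shuf z : z \in shuf (rcons u x) (rcons v y) ->
  (last x0 z == y) = (last x0 z != x).
Proof.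
move=> zuv; rewrite !last_rev -(@head_shuf x y x0 (rev u) (rev v)) //.
  by rewrite -!rev_rcons.
by rewrite -!rev_rcons (perm_mem (shuf_rev uv)) mem_map //; apply: inv_inj revK.
Qed.

End LastSum.

End ShuffleLists.

(** * From shuffle permutations to lists of shuffles *)

Lemma sorted_index (T : eqType) (z : seq T) :
  uniq z -> sorted (fun i j => (index i z < index j z)%N) z.
Proof.
case: z => // x0 z'; move: (x0 :: z') => z uz.
apply/(sortedP x0) => i lt_iz; rewrite /=.
by rewrite !index_uniq // ltnW.
Qed.

(** Expresses subsequences through increasing positions, the form in which [shuffles] constrains a
    permutation. Conversely, s and the filter of z by membership in s are sorted for the same strict
    order and have the same elements, hence are equal. *)
Lemma subseq_index (T : eqType) (s z : seq T) : uniq z ->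
  subseq s z = all (mem z) s && sorted (fun i j => (index i z < index j z)%N) s.
Proof.
move=> uz; have tr : transitive (fun i j => (index i z < index j z)%N).
  by move=> ? ? ? /=; apply: ltn_trans.
have ir : irreflexive (fun i j => (index i z < index j z)%N) by move=> ?; apply: ltnn.
apply/idP/andP=> [sz|[/allP sz ss]].
  split; first by apply/allP; apply: mem_subseq sz.
  exact: (subseq_sorted tr sz (sorted_index uz)).
apply/(subseq_uniqP uz); apply: (irr_sorted_eq tr ir) => //.
  exact/(sorted_filter tr)/sorted_index.
move=> t; rewrite mem_filter /=; apply/idP/andP => [ts|[]//].
by split=> //; apply: sz.
Qed.

Lemma inv_seq_uniq n (s : 'S_n) : uniq (inv_seq s).
Proof. by rewrite map_inj_uniq ?enum_uniq // => i j /val_inj/perm_inj. Qed.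

Lemma size_inv_seq n (s : 'S_n) : size (inv_seq s) = n.
Proof. by rewrite size_map size_enum_ord. Qed.

Lemma perm_inv_seq_iota n (s : 'S_n) : perm_eq (inv_seq s) (iota 0 n).
Proof.
apply: uniq_perm; rewrite ?inv_seq_uniq ?iota_uniq // => i.
rewrite mem_iota /=; apply/mapP/idP => [[j _ ->]|lt_in]; first by rewrite ltn_ord.
by exists (s (Ordinal lt_in)); rewrite ?mem_enum ?permK.
Qed.

(** This recovers s from [inv_seq s] and translates inequalities between values of s into the order
    of occurrence in the sequence. *)
Lemma index_inv_seq n (s : 'S_n) (i : 'I_n) : index (val i) (inv_seq s) = s i.
Proof.
rewrite -{1}(permK s i) /inv_seq.
rewrite (index_map (f := fun j => val ((s^-1)%g j))); last by move=> j l /val_inj/perm_inj.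
exact: index_enum_ord.
Qed.

Lemma nth_inv_seq n x0 (s : 'S_n) (i : 'I_n) : nth x0 (inv_seq s) i = (s^-1)%g i.
Proof. by rewrite /inv_seq (nth_map i) ?size_enum_ord // nth_ord_enum. Qed.

Lemma inv_seq_inj n : injective (@inv_seq n).
Proof.
move=> s t st; apply/permP => i; apply/val_inj.
by rewrite /= -!index_inv_seq st.
Qed.

(** The witness sends each number to its position in z. *)
Lemma inv_seq_surj n (z : seq nat) : perm_eq z (iota 0 n) ->
  exists s : 'S_n, inv_seq s = z.
Proof.
move=> zn; have sz : size z = n by rewrite (perm_size zn) size_iota.
have uz : uniq z by rewrite (perm_uniq zn) iota_uniq.
have lt_z (i : 'I_n) : (index (val i) z < n)%N.
  by rewrite -[X in (_ < X)%N]sz index_mem (perm_mem zn) mem_iota /=.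
have inj : injective (fun i => Ordinal (lt_z i)).
  move=> i j [] /(congr1 (nth 0%N z)); rewrite !nth_index ?(perm_mem zn) ?mem_iota ?ltn_ord //.
  exact: val_inj.
exists (perm inj); apply: (@eq_from_nth _ 0%N); rewrite size_inv_seq // => i lt_in.
have lt_zi : (nth 0%N z i < n)%N.
  have := mem_nth 0%N (s := z) (n := i); rewrite sz (perm_mem zn) mem_iota.
  exact.
rewrite -[i]/(val (Ordinal lt_in)) nth_inv_seq.
rewrite -[RHS]/(val (Ordinal lt_zi)); congr val; apply: (@perm_inj _ (perm inj)).
by rewrite permKV permE; apply: val_inj; rewrite /= index_uniq ?sz.
Qed.

Lemma iota_cat0 p q : iota 0 p ++ iota p q = iota 0 (p + q).
Proof. by rewrite iotaD. Qed.

(** By [mem_shuf] and [subseq_index], both sides say that s increases on the first p and on the last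
    q positions; the remaining conditions hold for every permutation. *)
Lemma mem_shuffles p q (s : 'S_(p + q)) :
  (s \in shuffles p q) = (inv_seq s \in shuf (iota 0 p) (iota p q)).
Proof.
rewrite mem_shuf iota_cat0 ?iota_uniq // perm_inv_seq_iota andbT.
rewrite !subseq_index ?inv_seq_uniq //.
have mem_inv i : (i \in inv_seq s) = (i < p + q)%N.
  by rewrite (perm_mem (perm_inv_seq_iota s)) mem_iota.
have -> : all (mem (inv_seq s)) (iota 0 p).
  by apply/allP => i; rewrite mem_iota /= mem_inv => /ltn_addr->.
have -> : all (mem (inv_seq s)) (iota p q).
  by apply/allP => i; rewrite mem_iota /= mem_inv => /andP[].
rewrite /=; have tr : transitive (fun i j => (index i (inv_seq s) < index j (inv_seq s))%N).
  by move=> ? ? ? /=; apply: ltn_trans.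
rewrite inE; apply/idP/andP => [/forallP sP|[sp sq]].
  have sP' i j : (i < j < p + q)%N -> ((j < p) || (p <= i))%N ->
      (index i (inv_seq s) < index j (inv_seq s))%N.
    case/andP=> lt_ij lt_j ij; have lt_i := ltn_trans lt_ij lt_j.
    have /forallP/(_ (Ordinal lt_j))/implyP := sP (Ordinal lt_i).
    by rewrite -!index_inv_seq; apply; apply/andP.
  split; apply/(sortedP 0%N) => i; rewrite size_iota => lt_i.
    rewrite !nth_iota ?(ltnW lt_i) //; apply: sP'; rewrite !add0n ?lt_i //.
    by rewrite ltnSn ltn_addr.
  rewrite !nth_iota ?(ltnW lt_i) //; apply: sP'; rewrite ?leq_addr ?orbT //.
  by rewrite addnS ltnSn -addnS ltn_add2l.
apply/forallP => i; apply/forallP => j; apply/implyP => /andP[lt_ij /orP[lt_jp|le_pi]].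
  have := sorted_ltn_nth tr 0%N sp; rewrite size_iota => /(_ i j).
  have lt_ip := ltn_trans lt_ij lt_jp.
  by rewrite !inE !nth_iota // !add0n -!index_inv_seq; apply.
(* The entry of rank r in [iota p q] is p + r, whence the shift by p. *)
have := sorted_ltn_nth tr 0%N sq; rewrite size_iota => /(_ (i - p) (j - p))%N.
have le_pj := leq_trans le_pi (ltnW lt_ij).
have lt_q (l : 'I_(p + q)) : (p <= l -> l - p < q)%N by move=> ?; rewrite ltn_subLR.
rewrite !inE !nth_iota ?lt_q // !subnKC // -!index_inv_seq; apply=> //.
by rewrite ltn_sub2r // (leq_ltn_trans le_pi).
Qed.

Lemma inv_seq_shuffles p q :
  perm_eq [seq inv_seq s | s <- enum (shuffles p q)] (shuf (iota 0 p) (iota p q)).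
Proof.
have upq : uniq (iota 0 p ++ iota p q) by rewrite iota_cat0 iota_uniq.
apply: uniq_perm; rewrite ?shuf_uniq ?map_inj_uniq ?enum_uniq //; first exact: inv_seq_inj.
move=> z; apply/mapP/idP => [[s + ->]|zS]; first by rewrite mem_enum mem_shuffles.
have [s sz] : exists s : 'S_(p + q), inv_seq s = z.
  by apply: inv_seq_surj; move: zS; rewrite mem_shuf // iota_cat0 => /and3P[].
by exists s; rewrite // mem_enum mem_shuffles sz.
Qed.

(** * Sums of shuffles in a ring, and cutting around a letter *)

Section ShuffleProduct.
Variables (A : nzRingType) (T : Type) (f : T -> A).
Implicit Types (u v w : seq T).

(** The alphabet is arbitrary because two are used: positions, which are pairwise distinct, and the
    vectors found there, which may repeat. *)
Definition shuffle u v : A := \sum_(z <- shuf u v) \prod_(x <- z) f x.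

Lemma shuffle0s v : shuffle [::] v = \prod_(x <- v) f x.
Proof. exact: big_seq1. Qed.

Lemma shuffles0 u : shuffle u [::] = \prod_(x <- u) f x.
Proof. by rewrite /shuffle shuf_nil big_seq1. Qed.

Lemma sum_shuf_cons x u v :
  \sum_(z <- shuf u v) \prod_(i <- x :: z) f i = f x * shuffle u v.
Proof. by rewrite mulr_sumr; apply: eq_bigr => z _; rewrite big_cons. Qed.

Lemma sum_shuf_rcons x u v :
  \sum_(z <- shuf u v) \prod_(i <- rcons z x) f i = shuffle u v * f x.
Proof.
by rewrite mulr_suml; apply: eq_bigr => z _; rewrite -cats1 big_cat big_seq1 /=.
Qed.

Lemma shuffle_cons x u y v : shuffle (x :: u) (y :: v) =
  f x * shuffle u (y :: v) + f y * shuffle (x :: u) v.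
Proof. by rewrite /shuffle shuf_cons big_cat !big_map !sum_shuf_cons. Qed.

(** The index i counts the letters of u placed before y. The proof is a double induction on u and v
    that splits off the first letter of the shuffle. *)
Lemma shuffle_cat u v y w : shuffle u (v ++ y :: w) =
  \sum_(i < (size u).+1) shuffle (take i u) v * f y * shuffle (drop i u) w.
Proof.
elim: u v => [|x u IHu] v.
  by rewrite big_ord1 !shuffle0s big_cat big_cons /= mulrA.
elim: v => [|z v IHv]; rewrite [RHS]big_ord_recl take0 drop0.
  rewrite cat0s shuffle_cons addrC -[y :: w]/([::] ++ _) IHu shuffle0s.
  rewrite big_nil mul1r [f x * _]mulr_sumr; congr (_ + _).
  by apply: eq_bigr => i _; rewrite lift0 take_cons drop_cons !shuffles0 big_cons !mulrA.
rewrite cat_cons shuffle_cons addrC -[z :: v ++ _]/((z :: v) ++ _) IHv IHu.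
rewrite big_ord_recl take0 drop0 mulrDr -addrA; congr (_ + _).
  by rewrite !shuffle0s big_cons !mulrA.
(* The empty prefix of [x :: u], settled above, arises only when z comes first. For each other
   prefix, the terms starting with x and with z recombine by [shuffle_cons]. *)
rewrite [f z * _]mulr_sumr [f x * _]mulr_sumr -big_split.
apply: eq_bigr => i _.
by rewrite lift0 take_cons drop_cons (shuffle_cons x _ z) /= addrC !mulrDl !mulrA.
Qed.

Lemma mul_shuffle_cat x u v y w : f x * shuffle u (v ++ y :: w) =
  \sum_(i < (size u).+1)
    f x * shuffle (take i u) v * (f y * shuffle (drop i u) w).
Proof. by rewrite shuffle_cat mulr_sumr; apply: eq_bigr => i _; rewrite !mulrA. Qed.

Lemma shuffle_cat_mul u v y w x : shuffle u (v ++ y :: w) * f x =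
  \sum_(i < (size u).+1)
    shuffle (take i u) v * f y * (shuffle (drop i u) w * f x).
Proof. by rewrite shuffle_cat mulr_suml; apply: eq_bigr => i _; rewrite !mulrA. Qed.

End ShuffleProduct.

(** Meant for [dwedge_cat], where the last cut leaves an empty suffix and contributes 0. *)
Lemma sum_mulr_ord_recr (A : nzRingType) n (a b : 'I_n.+1 -> A) :
  b ord_max = 0 -> \sum_i a i * b i =
    \sum_(i < n) a (widen_ord (leqnSn n) i) * b (widen_ord (leqnSn n) i).
Proof. by move=> b0; rewrite big_ord_recr /= b0 mulr0 addr0. Qed.

Lemma shuffle_map (A : nzRingType) (T U : Type) (f : U -> A) (h : T -> U) u v :
  shuffle f (map h u) (map h v) = shuffle (f \o h) u v.
Proof.
by rewrite /shuffle -map_shuf big_map; apply: eq_bigr => z _; rewrite big_map.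
Qed.

(** * The derived operations on words *)

Section Words.
Variables (k : fieldType) (V : lmodType k).
Implicit Types (u v w : seq V).

Definition letter (x : V) : tensor V := word [:: x].

Lemma word_prod u : word u = \prod_(x <- u) letter x.
Proof.
elim: u => [|x u IHu]; first by rewrite big_nil.
by rewrite big_cons -IHu -word_cat.
Qed.

Section NonemptyWords.
Variables (u v : seq V).
Hypotheses (u_n0 : u != [::]) (v_n0 : v != [::]).

Let p := size u.
Let q := size v.
Let L := shuf (iota 0 p) (iota p q).
Let g i := letter (nth 0 (u ++ v) i).
Let W z : tensor V := \prod_(i <- z) g i.

Let mapu : map (nth 0 (u ++ v)) (iota 0 p) = u.
Proof. by rewrite map_nth_iota0 ?size_cat ?leq_addr // take_size_cat. Qed.

Let mapv : map (nth 0 (u ++ v)) (iota p q) = v.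
Proof.
by rewrite map_nth_iota ?size_cat ?addKn // drop_size_cat // take_oversize.
Qed.

Let upq : uniq (iota 0 p ++ iota p q).
Proof. by rewrite -iotaD iota_uniq. Qed.

Let p_gt0 : (0 < p)%N. Proof. by rewrite lt0n size_eq0. Qed.
Let q_gt0 : (0 < q)%N. Proof. by rewrite lt0n size_eq0. Qed.

(** This and the next three facts expose 0, p, [p.-1] and [(p + q).-1], the end positions of the two
    words that [quadri_shuffle] tests for. *)
Let pl : iota 0 p = 0%N :: iota 1 p.-1.
Proof. by rewrite -{1}(prednK p_gt0). Qed.
Let ql : iota p q = p :: iota p.+1 q.-1.
Proof. by rewrite -{1}(prednK q_gt0). Qed.
Let pr : iota 0 p = rcons (iota 0 p.-1) p.-1.
Proof. by rewrite -cats1 -(iotaD 0 _ 1) addn1 prednK. Qed.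
Let qr : iota p q = rcons (iota p q.-1) (p + q).-1.
Proof.
have -> : (p + q).-1 = (p + q.-1)%N by rewrite -{1}(prednK q_gt0) addnS.
by rewrite -cats1 -(iotaD _ _ 1) addn1 prednK.
Qed.

(** Summing over lists of positions keeps the tests on the ends meaningful even when u and v share
    letters. *)
Let quadri_words a b : quadri a b (word u) (word v) =
  \sum_(z <- L | (head 0%N z == if a then p else 0%N)
      && (last 0%N z == if b then (p + q).-1 else p.-1)) W z.
Proof.
have -> : quadri a b (word u) (word v) = quadri_shuffle a b p q (u ++ v).
  by rewrite quadriE /p /q; case: u u_n0 => // ? ? _; case: v v_n0.
rewrite /quadri_shuffle -(perm_big _ (inv_seq_shuffles p q)) big_map big_enum_cond.
by apply: eq_big => [s|s _]; rewrite ?inE // word_prod big_map.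
Qed.

Let head_L z : z \in L -> (head 0%N z == p) = (head 0%N z != 0%N).
Proof. by rewrite /L pl ql; apply: head_shuf; rewrite -pl -ql. Qed.

Let last_L z : z \in L -> (last 0%N z == (p + q).-1) = (last 0%N z != p.-1).
Proof. by rewrite /L pr qr; apply: last_shuf; rewrite -pr -qr. Qed.

(** A shuffle ends with the last position of one of the two words, so adding two operations that
    differ only in this choice removes the condition. *)
Let sum_last (P : pred (seq nat)) :
  \sum_(z <- L | P z && (last 0%N z == p.-1)) W z
  + \sum_(z <- L | P z && (last 0%N z == (p + q).-1)) W z = \sum_(z <- L | P z) W z.
Proof.
rewrite [RHS](bigID (fun z => last 0%N z == p.-1)) /=; congr (_ + _).
rewrite big_seq_cond [RHS]big_seq_cond; apply: eq_bigl => z.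
by case: (boolP (z \in L)) => // /last_L->.
Qed.

Let sum_head (P : pred (seq nat)) :
  \sum_(z <- L | (head 0%N z == 0%N) && P z) W z
  + \sum_(z <- L | (head 0%N z == p) && P z) W z = \sum_(z <- L | P z) W z.
Proof.
rewrite [RHS](bigID (fun z => head 0%N z == 0%N)) /=.
congr (_ + _); first by apply: eq_bigl => z; rewrite andbC.
rewrite big_seq_cond [RHS]big_seq_cond; apply: eq_bigl => z.
by case: (boolP (z \in L)) => // /head_L->; rewrite !andTb andbC.
Qed.

Let shuffle_g s t : shuffle g s t =
  shuffle letter (map (nth 0 (u ++ v)) s) (map (nth 0 (u ++ v)) t).
Proof. by rewrite shuffle_map. Qed.

Lemma dprec_words x s : u = x :: s ->
  dprec (word u) (word v) = letter x * shuffle letter s v.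
Proof.
move=> def_u; rewrite /dprec /nwarrow /swarrow !quadri_words sum_last.
rewrite /L pl {1}ql sum_shuf_headl -?ql -?pl // sum_shuf_cons shuffle_g mapv.
(* Reading off letters: position 0 carries x and the positions 1 to [p.-1] carry s. *)
by move: mapu; rewrite pl [RHS]def_u => -[<- <-].
Qed.

Lemma dsucc_words y t : v = y :: t ->
  dsucc (word u) (word v) = letter y * shuffle letter u t.
Proof.
move=> def_v; rewrite /dsucc /nearrow /searrow !quadri_words sum_last.
rewrite /L {1}pl ql sum_shuf_headr -?ql -?pl // sum_shuf_cons shuffle_g mapu.
by move: mapv; rewrite ql [RHS]def_v => -[<- <-].
Qed.

Lemma dwedge_words x s : u = rcons s x ->
  dwedge (word u) (word v) = shuffle letter s v * letter x.
Proof.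
move=> def_u; rewrite /dwedge /nearrow /nwarrow !quadri_words addrC sum_head.
rewrite /L pr {1}qr sum_shuf_lastl -?qr -?pr // sum_shuf_rcons shuffle_g mapv.
by move: mapu; rewrite pr [RHS]def_u map_rcons => /rcons_inj[<- <-].
Qed.

Lemma dvee_words y t : v = rcons t y ->
  dvee (word u) (word v) = shuffle letter u t * letter y.
Proof.
move=> def_v; rewrite /dvee /searrow /swarrow !quadri_words addrC sum_head.
rewrite /L {1}pr qr sum_shuf_lastr -?qr -?pr // sum_shuf_rcons shuffle_g mapu.
by move: mapv; rewrite qr [RHS]def_v map_rcons => /rcons_inj[<- <-].
Qed.

End NonemptyWords.

Lemma dprec_cons x u v : v != [::] ->
  dprec (word (x :: u)) (word v) = letter x * shuffle letter u v.
Proof. by move=> v_n0; apply: dprec_words. Qed.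

Lemma dprec_nil v : v != [::] -> dprec (word [::]) (word v) = 0.
Proof. by case: v => // y v _; rewrite /dprec /nwarrow /swarrow !quadriE addr0. Qed.

(** The empty u fits the same formula, thanks to the convention that [searrow] has the empty word as
    left unit; [dprec] and [dwedge] vanish there instead. *)
Lemma dsucc_cons u y v :
  dsucc (word u) (word (y :: v)) = letter y * shuffle letter u v.
Proof.
case: u => [|x u]; last exact: dsucc_words.
have -> : letter y * shuffle letter [::] v = word (y :: v).
  by rewrite shuffle0s word_prod big_cons.
by rewrite /dsucc /nearrow /searrow !quadriE add0r.
Qed.

Lemma dwedge_rcons x u v : v != [::] ->
  dwedge (word (rcons u x)) (word v) = shuffle letter u v * letter x.
Proof. by move=> v_n0; apply: dwedge_words => //; rewrite -size_eq0 size_rcons. Qed.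

Lemma dwedge_nil v : v != [::] -> dwedge (word [::]) (word v) = 0.
Proof. by case: v => // y v _; rewrite /dwedge /nearrow /nwarrow !quadriE addr0. Qed.

Lemma dvee_rcons u y v :
  dvee (word u) (word (rcons v y)) = shuffle letter u v * letter y.
Proof.
case: u => [|x u]; last first.
  by apply: dvee_words => //; rewrite -size_eq0 size_rcons.
have -> : shuffle letter [::] v * letter y = word (rcons v y).
  by rewrite shuffle0s -word_prod -word_cat cats1.
by case: v => [|? ?]; rewrite /dvee /searrow /swarrow !quadriE addr0.
Qed.

(** The last letter of w is factored out on the right, and the shuffles are cut around the last
    letter of v. *)
Lemma dvee_cat u v w : v != [::] -> w != [::] ->
  dvee (word u) (word v * word w) = \sum_(i < (size u).+1)
    dvee (word (take i u)) (word v) * dvee (word (drop i u)) (word w).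
Proof.
case/lastP: v => // v y _; case/lastP: w => // w z _.
rewrite -word_cat -cats1 -catA cat1s -rcons_cons -rcons_cat dvee_rcons cats1.
by rewrite shuffle_cat_mul; apply: eq_bigr => i _; rewrite !dvee_rcons.
Qed.

(** The first letter of v is factored out on the left, and the cut is made around the first letter
    of w. *)
Lemma dsucc_cat u v w : v != [::] -> w != [::] ->
  dsucc (word u) (word v * word w) = \sum_(i < (size u).+1)
    dsucc (word (take i u)) (word v) * dsucc (word (drop i u)) (word w).
Proof.
case: v w => // y v [|z w] // _ _; rewrite -word_cat cat_cons dsucc_cons.
by rewrite mul_shuffle_cat; apply: eq_bigr => i _; rewrite !dsucc_cons.
Qed.

Lemma dprec_cat u v w : v != [::] -> w != [::] ->
  dprec (word u) (word v * word w) = \sum_(i < (size u).+1)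
    dprec (word (take i u)) (word v) * dsucc (word (drop i u)) (word w).
Proof.
move=> v_n0; case: w => // z w _.
have vw : v ++ z :: w != [::] by case: (v).
rewrite -word_cat; case: u => [|x u].
  by rewrite big_ord1 !dprec_nil ?mul0r.
(* The cut with empty prefix contributes 0; every other prefix starts with x, which is factored out
   on the left. *)
rewrite (dprec_cons _ _ vw) big_ord_recl take0 (dprec_nil v_n0) mul0r add0r.
rewrite mul_shuffle_cat; apply: eq_bigr => i _.
by rewrite lift0 take_cons drop_cons (dprec_cons _ _ v_n0) dsucc_cons.
Qed.

Lemma dwedge_cat u v w : v != [::] -> w != [::] ->
  dwedge (word u) (word v * word w) = \sum_(i < (size u).+1)
    dvee (word (take i u)) (word v) * dwedge (word (drop i u)) (word w).
Proof.
move=> + w_n0; case/lastP: v => // v y _.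
have vw : rcons v y ++ w != [::] by rewrite -size_eq0 size_cat size_rcons.
rewrite -word_cat; case/lastP: u => [|u x].
  by rewrite big_ord1 !dwedge_nil ?mulr0.
rewrite (dwedge_rcons _ _ vw) -cats1 -catA cat1s cats1 shuffle_cat_mul.
(* The cut after x has empty suffix and contributes 0; in every other cut the suffix ends with x. *)
have drop_u : drop (size u).+1 (rcons u x) = [::].
  by rewrite -(size_rcons u x) drop_size.
rewrite size_rcons [RHS]sum_mulr_ord_recr; last by rewrite /= drop_u dwedge_nil.
apply: eq_bigr => i _; have le_iu : (i <= size u)%N by rewrite -ltnS.
by rewrite (drop_rcons le_iu) (dwedge_rcons _ _ w_n0) dvee_rcons -cats1 takel_cat.
Qed.

End Words.

(** * Extension from words to tensors by linearity *)

Section LinearMaps.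
Variables (k : fieldType) (U M : lmodType k) (A : algType k).

Lemma linear_comp (N : lmodType k) (f : U -> M) (g : M -> N) :
  linear f -> linear g -> linear (g \o f).
Proof. by move=> fl gl c x y /=; rewrite fl gl. Qed.

Lemma linear_mull (f : U -> A) a : linear f -> linear (fun x => f x * a).
Proof. by move=> fl c x y; rewrite fl mulrDl scalerAl. Qed.

Lemma linear_mulr (f : U -> A) a : linear f -> linear (fun x => a * f x).
Proof. by move=> fl c x y; rewrite fl mulrDr scalerAr. Qed.

Lemma linear_sum (I : finType) (f : I -> U -> M) :
  (forall i, linear (f i)) -> linear (fun x => \sum_i f i x).
Proof.
move=> fl c x y; rewrite scaler_sumr -big_split /=.
by apply: eq_bigr => i _; rewrite fl.
Qed.

Lemma linear_add (f g : U -> M) :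
  linear f -> linear g -> linear (fun x => f x + g x).
Proof. by move=> fl gl c x y; rewrite fl gl scalerDr addrACA. Qed.

Lemma linear_id : linear (@id U).
Proof. by []. Qed.

End LinearMaps.

Section BilinearExtension.
Variables (k : fieldType) (V : lmodType k).
Notation H := (tensor V).

Definition bilin (f : H -> H -> H) :=
  (forall y, linear (f^~ y)) /\ (forall x, linear (f x)).

Lemma bilin_quadriD a b c d : bilin (fun x y => quadri a b x y + quadri c d x y).
Proof.
split=> x.
  exact: (linear_add (quadri_linl a b x) (quadri_linl c d x)).
exact: (linear_add (quadri_linr a b x) (quadri_linr c d x)).
Qed.

Lemma linear_pos_ext (M : lmodType k) (f g : H -> M) :
    linear f -> linear g ->
    (forall s : seq V, s != [::] -> f (word s) = g (word s)) ->
  forall x, tensor_pos x -> f x = g x.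
Proof.
move=> fl gl fg x; elim=> [|c _ y [s s0 ->] _ IH]; first by rewrite !linear_at0.
by rewrite fl gl IH fg.
Qed.

(** Both sides are linear in each of u, v and w, so words suffice; for v and w nonempty ones do, as
    they span the positive part. *)
Lemma mul_words_ext (h f g : H -> H -> H) : bilin h -> bilin f -> bilin g ->
    (forall u v w : seq V, v != [::] -> w != [::] ->
       h (word u) (word v * word w) = \sum_(i < (size u).+1)
         f (word (take i u)) (word v) * g (word (drop i u)) (word w)) ->
  forall u v w, tensor_pos v -> tensor_pos w ->
    h u (v * w) = sum_deconc (fun u1 u2 => f u1 v * g u2 w) u.
Proof.
move=> [hl hr] [fl fr] [gl gr] hfg u v w vP wP.
(* Bilinearity in the two factors lets the summand descend to the tensor product, where [deconc u]
   lives. *)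
have Bl y : linear (fun x => f x v * g y w) by apply: linear_mull (fl v).
have Br x : linear (fun y => f x v * g y w) by apply: linear_mulr (gl w).
apply: (linear_word_ext (f := h^~ (v * w))) u => [||u]; first exact: hl.
  exact: (linear_comp (@deconc_linear k V) (tlift_linear Bl Br)).
rewrite [RHS](sum_deconc_word u Bl Br).
(* Now that u is a word, the right-hand side is a finite sum whose linearity in v, then in w, is
   checked termwise. *)
apply: (linear_pos_ext (f := fun v => h (word u) (v * w))
  (g := fun v => \sum_(i < _) f (word (take i u)) v * g (word (drop i u)) w)) vP.
- exact: (linear_comp (linear_mull w (@linear_id _ H)) (hr (word u))).
- by apply: linear_sum => i; apply: linear_mull (fr _).
move=> {v Bl Br} {}v v0.
apply: (linear_pos_ext (f := fun w => h (word u) (word v * w))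
  (g := fun w => \sum_(i < _) f (word (take i u)) (word v) * g (word (drop i u)) w)) wP.
- exact: (linear_comp (linear_mulr (word v) (@linear_id _ H)) (hr (word u))).
- by apply: linear_sum => i; apply: linear_mulr (gr _).
by move=> {}w w0; apply: hfg.
Qed.

End BilinearExtension.

Theorem corollary1 (k : fieldType) (V : lmodType k) (u v w : tensor V)
    (hv : tensor_pos v) (hw : tensor_pos w) :
  [/\ u \wedge (v * w) = u \nearrow (v * w) + u \nwarrow (v * w)
      /\ u \nearrow (v * w) + u \nwarrow (v * w)
         = sum_deconc (fun u1 u2 => (u1 \vee v) * (u2 \wedge w)) u,
      u \prec (v * w) = u \nwarrow (v * w) + u \swarrow (v * w)
      /\ u \nwarrow (v * w) + u \swarrow (v * w)
         = sum_deconc (fun u1 u2 => (u1 \prec v) * (u2 \succ w)) u,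
      u \vee (v * w) = u \swarrow (v * w) + u \searrow (v * w)
      /\ u \swarrow (v * w) + u \searrow (v * w)
         = sum_deconc (fun u1 u2 => (u1 \vee v) * (u2 \vee w)) u
    & u \succ (v * w) = u \searrow (v * w) + u \nearrow (v * w)
      /\ u \searrow (v * w) + u \nearrow (v * w)
         = sum_deconc (fun u1 u2 => (u1 \succ v) * (u2 \succ w)) u].
Proof.
have sP : bilin (@dsucc k V) by exact: bilin_quadriD.
have pP : bilin (@dprec k V) by exact: bilin_quadriD.
have veeP : bilin (@dvee k V) by exact: bilin_quadriD.
have wedgeP : bilin (@dwedge k V) by exact: bilin_quadriD.
(* Here and for [dsucc] the statement lists the two summands in the order opposite to the
   definition. *)
have vee_comm : u \vee (v * w) = u \swarrow (v * w) + u \searrow (v * w).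
  exact: addrC.
have succ_comm : u \succ (v * w) = u \searrow (v * w) + u \nearrow (v * w).
  exact: addrC.
split; split.
- exact (erefl (u \wedge (v * w))).
- exact: (mul_words_ext wedgeP veeP wedgeP (@dwedge_cat k V) u hv hw).
- exact (erefl (u \prec (v * w))).
- exact: (mul_words_ext pP pP sP (@dprec_cat k V) u hv hw).
- exact: vee_comm.
- rewrite -vee_comm.
  exact: (mul_words_ext veeP veeP veeP (@dvee_cat k V) u hv hw).
- exact: succ_comm.
- rewrite -succ_comm.
  exact: (mul_words_ext sP sP sP (@dsucc_cat k V) u hv hw).
Qed.
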